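(* There exists a compact set $E\subset\mathbb{R}$ such that $0$ is a Lebesgue density point of $E$, but $E$ does not contain any infinite geometric progression; that is, there are no $a\in\mathbb{R}\setminus\{0\}$ and $q\in(0,1)$ such that $aq^n\in E$ for all integers $n\ge 1$.
   Context: $\lambda$ denotes Lebesgue measure on $\mathbb{R}$. A point $x$ is a Lebesgue density point of a measurable set $E\subset\mathbb{R}$ if $\lim_{t\to 0^+}\lambda(E\cap[x-t,x+t])/(2t)=1$. By convention, infinite geometric progressions are non-constant sequences $(aq^n)_{n=1}^\infty$ with $a\ne 0$ and ratio $q\in(0,1)$. *)

(* Defs.v *)
From mathcomp Require Import all_boot all_order all_algebra.
From mathcomp Require Import all_classical all_reals all_analysis.
Set Implicit Arguments.
Unset Strict Implicit.
Unset Printing Implicit Defensive.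
Import Order.TTheory GRing.Theory Num.Theory.
Import numFieldNormedType.Exports.
Local Open Scope classical_set_scope.
Local Open Scope ring_scope.

(* Meaningful for measurable [E] only: on other sets [lebesgue_measure]
   returns the outer measure. Compact sets are Borel. *)
Definition lebesgue_density_point (R : realType) (E : set R) (x : R) : Prop :=
  (lebesgue_measure (E `&` `[(x - t)%R, (x + t)%R]) * ((2 * t)^-1)%:E)%E
    @[t --> (0 : R)^'+] --> 1%E.

Definition contains_geometric_progression (R : realType) (E : set R) : Prop :=
  exists a q : R, [/\ a != 0, 0 < q < 1 &
    forall n : nat, (1 <= n)%N -> E (a * q ^+ n)].

(* Main.v *)
Require Import Defs.
From mathcomp Require Import all_boot all_order all_algebra.
From mathcomp Require Import all_classical all_reals all_analysis.
From mathcomp Require Import ring lra.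
Import Order.TTheory GRing.Theory Num.Theory.
Import numFieldNormedType.Exports.
Set Implicit Arguments.
Local Open Scope classical_set_scope.
Local Open Scope ring_scope.

(** Write x = exp (- u).  Geometric progressions in x tending to 0 become
arithmetic progressions b + n d in u tending to infinity, and a neighbourhood
of 0 becomes a neighbourhood of infinity.  Let phi u = u^(3/2), let the cut
points s_j be the values of x at which phi u = j, so that
s_j = exp (- j^(2/3)), and remove from [-1, 1] all x such that |x| lies in
]s_{j+1}, s_{j+1} + e_j (s_j - s_{j+1})[ for some j, where e_j is of order
j^(-1/9).  What remains is compact.

The point 0 is a density point (gapless_density) because the gaps take up at
most a proportion e_j of each interval between consecutive cut points: for
s_{J+1} < t <= s_J the gaps inside [0, t] have total length at most e_J s_J by
telescoping, and s_J is at most a fixed multiple of t.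

Every progression falls into a gap (geometric_meets_gap).  In the variable u,
being in a gap means that phi u is below an integer by a small amount, of
order u^(-1/6) (just_below_integer_in_gap).  Along u = b + n d the first
differences of phi increase to infinity, while its second differences tend
to 0: they are at most d^2 u^(-1/2).  So the first differences cross every
large integer p slowly.  Just after the crossing they exceed p by about
u^(-1/6), and they keep doing so for about u^(1/6) consecutive steps, since
the second differences are much smaller than (u^(-1/6))^2.  Modulo 1 the
values of phi thus advance by small steps all the way round the circle, and
one of them lands just below an integer (progression_just_below_integer).
The exponent 3/2 enters through this balance: phi must grow faster than
linearly, with second differences tending to 0.

To keep the algebra polynomial, the proofs use k = u^(1/6), so that u = k^6,
sqrt u = k^3 and phi u = k^9. *)

(** * Differences of cubes along equally spaced squares *)

(** Here u, v and w are the square roots of three equally spaced points, and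
cubing them gives the values of phi.  The bound makes the first differences of
phi along an arithmetic progression tend to infinity. *)
Lemma cube_step (R : realFieldType) (d u v : R) :
  0 < u -> 0 < v -> 0 < d -> v ^+ 2 = u ^+ 2 + d -> d * u <= v ^+ 3 - u ^+ 3.
Proof.
move=> u0 v0 d0 E.
have uv : u <= v by nra.
have -> : v ^+ 3 = v * (u ^+ 2 + d) by rewrite -E -exprS.
nra.
Qed.

(** Convexity of phi: its first differences increase, so that they do not fall
back below an integer once they have crossed it. *)
Lemma cube_convex (R : realFieldType) (d u v w : R) :
  0 < u -> 0 < v -> 0 < w -> 0 < d ->
  v ^+ 2 = u ^+ 2 + d -> w ^+ 2 = v ^+ 2 + d ->
  v ^+ 3 - u ^+ 3 <= w ^+ 3 - v ^+ 3.
Proof.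
move=> u0 v0 w0 d0 E F.
have uv : u <= v by nra.
have vw : v <= w by nra.
(* In these terms the claim is v^2 (x - y) <= d (x + y), where x - y is
   quadratic in x and y because both steps have the same square increment. *)
pose x := v - u; pose y := w - v.
have hx : 2 * v * x - x ^+ 2 = d by rewrite /x; lra.
have hy : 2 * v * y + y ^+ 2 = d by rewrite /y; lra.
have x0 : 0 <= x by rewrite /x; lra.
have y0 : 0 <= y by rewrite /y; lra.
have xy : 2 * v * (x - y) = x ^+ 2 + y ^+ 2 by lra.
have yx : y <= x by nra.
have dx : v * x <= d by rewrite /x in hx *; nra.
have -> : w = v + y by rewrite /y; lra.
have -> : u = v - x by rewrite /x; lra.
rewrite -subr_ge0.
have -> : (v + y) ^+ 3 - v ^+ 3 - (v ^+ 3 - (v - x) ^+ 3) =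
  - (v ^+ 2 * (x - y)) + (2 * v * y + y ^+ 2) * (v + y) - (2 * v * x - x ^+ 2) * (v - x).
  by ring.
rewrite hx hy.
have -> : v ^+ 2 * (x - y) = v * (x ^+ 2 + y ^+ 2) / 2 by rewrite -xy; field.
have : v * x ^+ 2 <= d * x by nra.
have : y ^+ 2 <= x ^+ 2 by nra.
have : 0 <= d * y by nra.
nra.
Qed.

(** The second difference equals v^2 (w + u - 2 v) + d (w - u).  The first term
is nonpositive, the square root being concave, and w - u = 2 d / (w + u). *)
Lemma cube_second_diff (R : realFieldType) (d u v w : R) :
  0 < u -> 0 < v -> 0 < w -> 0 < d ->
  v ^+ 2 = u ^+ 2 + d -> w ^+ 2 = v ^+ 2 + d ->
  (w ^+ 3 - v ^+ 3) - (v ^+ 3 - u ^+ 3) <= d ^+ 2 / u.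
Proof.
move=> u0 v0 w0 d0 E F.
have uv : u <= v by nra.
have vw : v <= w by nra.
have c : w + u - 2 * v <= 0.
  have : (w + u) ^+ 2 <= (2 * v) ^+ 2 by have := sqr_ge0 (w - u); lra.
  nra.
have wu : (w - u) * u <= d by nra.
rewrite ler_pdivlMr //.
have -> : w ^+ 3 = w * (v ^+ 2 + d) by rewrite -F -exprS.
have -> : u ^+ 3 = u * (v ^+ 2 - d) by rewrite E; ring.
have -> : w * (v ^+ 2 + d) - v ^+ 3 - (v ^+ 3 - u * (v ^+ 2 - d)) =
  v ^+ 2 * (w + u - 2 * v) + d * (w - u) by ring.
have : v ^+ 2 * (w + u - 2 * v) <= 0 by rewrite mulr_ge0_le0 ?sqr_ge0.
nra.
Qed.

(** This bound and the next one compare increments of u = v^2 with increments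
of phi u = v^3: the ratio of the two is 1 / v up to constants. *)
Lemma sqr_cube_ratio (R : realFieldType) (u v e : R) :
  0 < v -> 0 <= u -> u <= v -> v ^+ 3 - u ^+ 3 <= e ->
  v * (v ^+ 2 - u ^+ 2) <= 4 / 3 * e.
Proof.
move=> v0 u0 uv h.
suff : 3 * (v * (v ^+ 2 - u ^+ 2)) <= 4 * (v ^+ 3 - u ^+ 3) by lra.
have -> : 3 * (v * (v ^+ 2 - u ^+ 2)) = (v - u) * (3 * (v * (v + u))) by ring.
have -> : 4 * (v ^+ 3 - u ^+ 3) = (v - u) * (4 * (v ^+ 2 + v * u + u ^+ 2)) by ring.
apply: ler_wpM2l; first lra.
have := sqr_ge0 (v + 2 * u); nra.
Qed.

Lemma sqr_cube_ratio_lower (R : realFieldType) (u v : R) :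
  0 < v -> 0 <= u -> u <= v ->
  2 / 3 * (v ^+ 3 - u ^+ 3) <= v * (v ^+ 2 - u ^+ 2).
Proof.
move=> v0 u0 uv.
suff : 2 * (v ^+ 3 - u ^+ 3) <= 3 * (v * (v ^+ 2 - u ^+ 2)) by lra.
have -> : 3 * (v * (v ^+ 2 - u ^+ 2)) = (v - u) * (3 * (v * (v + u))) by ring.
have -> : 2 * (v ^+ 3 - u ^+ 3) = (v - u) * (2 * (v ^+ 2 + v * u + u ^+ 2)) by ring.
apply: ler_wpM2l; first lra.
nra.
Qed.

(** * Progressions approach the cut points from below *)

(** The walk rises by at least 1 in N steps, so it passes an integer M, and it
cannot jump over [M - hi, M[. *)
Lemma slow_walk (R : realType) (g : nat -> R) (N : nat) (lo hi : R) :
  (forall i, (i < N)%N -> lo <= g i.+1 - g i <= hi) -> 1 <= N%:R * lo ->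
  exists i (M : int), (i < N)%N /\ M%:~R - hi <= g i < M%:~R.
Proof.
move=> st N1.
pose M := Num.floor (g 0%N) + 1.
have [gM Mg] : g 0%N < M%:~R /\ M%:~R <= g 0%N + 1.
  have := floor_itv (g 0%N); rewrite /M intrD => /andP[??]; split; lra.
have grow : forall i, (i <= N)%N -> g 0%N + i%:R * lo <= g i.
  elim=> [|i IH] iN; first by rewrite mul0r addr0.
  have /andP[h _] := st _ iN; have := IH (ltnW iN).
  rewrite -natr1; lra.
have ex : exists i, (i <= N)%N && (M%:~R <= g i).
  by exists N; rewrite leqnn; have := grow N (leqnn N); lra.
case: (ex_minnP ex) => -[|i] /andP[iN gi] mini; first by lra.
exists i, M; split => //.
have /andP[_ h] := st _ iN.
have lt : g i < M%:~R.
  by rewrite ltNge; apply/negP => c; have := mini i; rewrite c (ltnW iN) ltnn => /(_ isT).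
by apply/andP; split => //; lra.
Qed.

(** The values k n are the sixth roots of the terms of an arithmetic progression
of difference d.  Bounding k 0 from below only means that the progression is
entered late enough; the distance to the integer is measured on the scale on
which the gaps shrink. *)
Lemma progression_just_below_integer (R : realType) (d : R) (k : nat -> R) :
  0 < d -> (forall n, 0 < k n) -> (forall n, k n.+1 ^+ 6 = k n ^+ 6 + d) ->
  1 <= k 0%N -> d <= k 0%N -> 3 * d ^+ 2 <= k 0%N ->
  exists m j : nat, j.+1%:R - 4 / k m <= k m ^+ 9 < j.+1%:R.
Proof.
move=> d0 kp kS k1 kd kdd.
have kle n m : (n <= m)%N -> k n <= k m.
  move=> nm; rewrite -(@ler_pXn2r _ 6%N) ?nnegrE ?(ltW (kp _)) //.
  rewrite -(subnKC nm); elim: (m - n)%N => [|i IH]; first by rewrite addn0.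
  by rewrite addnS kS; lra.
pose w n := k n ^+ 3.
have wp n : 0 < w n by rewrite exprn_gt0.
have w2 n : w n ^+ 2 = k n ^+ 6 by rewrite /w -exprM.
have w3 n : w n ^+ 3 = k n ^+ 9 by rewrite /w -exprM.
have wS n : w n.+1 ^+ 2 = w n ^+ 2 + d by rewrite !w2 kS.
have kn i n : k (n + i)%N ^+ 6 = k n ^+ 6 + i%:R * d.
  elim: i => [|i IH]; first by rewrite addn0 mul0r addr0.
  by rewrite addnS kS IH -natr1; ring.
pose D n := w n.+1 ^+ 3 - w n ^+ 3.
have Dge n : d * w n <= D n by apply: cube_step.
have Dmono n i : D n <= D (n + i)%N.
  elim: i => [|i IH]; first by rewrite addn0.
  by apply: le_trans IH _; rewrite addnS; apply: (@cube_convex _ d).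
have Dvar n i : D (n + i)%N <= D n + i%:R * (d ^+ 2 / w n).
  elim: i => [|i IH]; first by rewrite addn0 mul0r addr0.
  rewrite addnS -natr1.
  have h : D (n + i).+1 - D (n + i)%N <= d ^+ 2 / w (n + i)%N by apply: cube_second_diff.
  have : d ^+ 2 / w (n + i)%N <= d ^+ 2 / w n.
    apply: ler_wpM2l; first exact: sqr_ge0.
    by rewrite lef_pV2 ?posrE // /w lerXn2r ?nnegrE ?(ltW (kp _)) ?kle ?leq_addr.
  lra.
(* The first n + 1 at which the first difference exceeds the integer p by the
   inverse of k (n + 1) starts the walk.  Minimality bounds the excess at n, and
   cube_second_diff bounds it during the following N steps. *)
pose p : int := Num.floor (D 0%N) + 1.
have pD : D 0%N < p%:~R.
  by have := floor_itv (D 0%N); rewrite /p => /andP[].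
have kinv n : 0 < (k n)^-1 <= 1.
  rewrite invr_gt0 kp invf_le1 //=.
  exact: le_trans k1 (kle _ _ (leq0n n)).
have ex : exists n, p%:~R + (k n)^-1 <= D n.
  pose X := ((`|p%:~R| + 1) / d) ^+ 2 / d.
  have X0 : 0 <= X by rewrite /X divr_ge0 ?sqr_ge0 ?ltW.
  have := archi_boundP X0; set n := Num.bound X => nX; exists n.
  have : (`|p%:~R| + 1) / d <= w n.
    rewrite -(@ler_pXn2r _ 2%N) ?nnegrE ?(ltW (wp _)) //; last first.
      by rewrite divr_ge0 ?ltW // ltr_wpDl.
    rewrite w2 -[n]add0n kn.
    have : X * d <= n%:R * d by rewrite ler_pM2r // ltW.
    rewrite /X divfK ?gt_eqF // => h.
    by have := exprn_gt0 6 (kp 0%N); lra.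
  rewrite ler_pdivrMr // mulrC => h.
  have := Dge n; have := ler_norm (p%:~R : R); have := kinv n; lra.
case: (ex_minnP ex) => -[|n] hn mini.
  by have := kinv 0%N; lra.
have Dn : D n < p%:~R + (k n)^-1.
  by rewrite ltNge; apply/negP => /mini; rewrite ltnn.
pose K := k n.
have K1 : 1 <= K by apply: le_trans k1 (kle _ _ _).
have Kd : d <= K by apply: le_trans kd (kle _ _ _).
have Kdd : 3 * d ^+ 2 <= K by apply: le_trans kdd (kle _ _ _).
have K0 : 0 < K by apply: kp.
have K20 : 0 <= 2 * K by lra.
(* The excess is at least 1 / (2 K), because k at most doubles during the walk;
   hence 2 K steps suffice to advance by 1. *)
pose N := (Num.truncn (2 * K)).+1.
have [N1 N2] : 2 * K <= N%:R /\ N%:R <= 3 * K.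
  have := truncn_itv K20; rewrite /N -natr1 => /andP[]; split; lra.
have kK i : (i <= N)%N -> k (n + i)%N <= 2 * K.
  move=> iN; rewrite -(@ler_pXn2r _ 6%N) ?nnegrE ?(ltW (kp _)) //.
  rewrite kn -/K.
  have h : i%:R * d <= 3 * K * K.
    apply: ler_pM => //; first exact: ltW.
    by apply: le_trans N2; rewrite ler_nat.
  have : K * K <= K ^+ 6 by rewrite -expr2 ler_weXn2l.
  have -> : (2 * K) ^+ 6 = 64 * K ^+ 6 by ring.
  by have := mulr_gt0 K0 K0; lra.
have NK : 1 <= N%:R * (2 * K)^-1 by rewrite ler_pdivlMr ?mul1r; lra.
pose g i := w (n.+1 + i)%N ^+ 3 - (p%:~R * (n.+1 + i)%:R).
have [|i [M [iN /andP[gM Mg]]]] := @slow_walk R g N (2 * K)^-1 (2 / K) _ NK.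
  move=> i iN; rewrite /g.
  have -> : w (n.+1 + i.+1)%N ^+ 3 - p%:~R * (n.+1 + i.+1)%:R -
     (w (n.+1 + i)%N ^+ 3 - p%:~R * (n.+1 + i)%:R) = D (n.+1 + i)%N - p%:~R.
    by rewrite /D addnS -natr1; ring.
  have a1 : (2 * K)^-1 <= (k n.+1)^-1.
    rewrite lef_pV2 ?posrE //; last by lra.
    by rewrite -addn1 kK.
  have a2 := Dmono n.+1 i.
  have a3 : D (n.+1 + i)%N <= D n + i.+1%:R * (d ^+ 2 / w n).
    by have := Dvar n i.+1; rewrite addnS -addSn.
  have a4 : i.+1%:R * (d ^+ 2 / w n) <= K^-1.
    have -> : w n = K ^+ 3 by [].
    rewrite mulrA ler_pdivrMr ?exprn_gt0 //.
    have -> : K^-1 * K ^+ 3 = K * K by rewrite !exprS expr0; field; rewrite gt_eqF.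
    have : i.+1%:R <= 3 * K :> R by apply: le_trans N2; rewrite ler_nat.
    have : 0 <= d ^+ 2 by apply: sqr_ge0.
    nra.
  by rewrite -/K in Dn; apply/andP; split; lra.
(* The multiple of p subtracted in g is an integer, so distances to the
   nearest integer above are the same for g and for k ^+ 9. *)
pose m := (n.+1 + i)%N.
pose J : int := M + p * m%:Z.
have JE : J%:~R = M%:~R + p%:~R * m%:R :> R by rewrite /J rmorphD rmorphM.
have up : k m ^+ 9 < J%:~R by rewrite JE -w3; move: Mg; rewrite /g -/m; lra.
have lo : J%:~R - 2 / K <= k m ^+ 9 by rewrite JE -w3; move: gM; rewrite /g -/m; lra.
have J0 : (0 < J)%R.
  by rewrite -(@ltr0z R); apply: lt_trans up; rewrite exprn_gt0.
have [j Jj] : exists j : nat, J = j.+1.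
  by case: J J0 {JE up lo} => // -[|j] // _; exists j.
exists m, j; move: up lo; rewrite Jj => -> lo; rewrite andbT.
apply: le_trans lo; rewrite lerD2l lerN2.
have -> : 2 / K = 4 / (2 * K) by field; rewrite gt_eqF.
apply: ler_wpM2l => //; rewrite lef_pV2 ?posrE //; last by lra.
by rewrite /m addSnnS kK.
Qed.

(** * Sets with thin gaps *)

Definition gap {R : realType} (s e : nat -> R) (j : nat) : set R :=
  `]s j.+1, s j.+1 + e j * (s j - s j.+1)[.

Definition gapless {R : realType} (s e : nat -> R) : set R :=
  [set x | `|x| <= 1 /\ forall j, ~ gap s e j `|x|].

Lemma gapless_compact (R : realType) (s e : nat -> R) : compact (gapless s e).
Proof.
have -> : gapless s e = `[-1, 1] `&` Num.norm @^-1` (~` \bigcup_j gap s e j).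
  apply/seteqP; split => x /=; rewrite in_itv /= -ler_norml => -[x1 h]; split => //.
    by move=> [j _]; apply: h.
  by move=> j hj; apply: h; exists j.
apply: compact_closedI; first exact: segment_compact.
apply: closed_comp; first by move=> x _; apply: norm_continuous.
by apply: open_closedC; apply: bigcup_open => j _; exact: interval_open.
Qed.

Lemma gapless_measurable (R : realType) (s e : nat -> R) (t : R) :
  measurable (gapless s e `&` `[- t, t]).
Proof.
apply: measurableI.
  by apply: measurable_realfun.compact_measurable; exact: gapless_compact.
exact: measurable_itv.
Qed.

Lemma lebesgue_itv_sym (R : realType) (t : R) :
  0 < t -> lebesgue_measure (`[- t, t]%classic : set R) = (2 * t)%:E.
Proof.
move=> t0; rewrite lebesgue_measure_itv /= lte_fin (_ : - t < t); last by lra.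
by rewrite -EFinD; congr (_%:E); ring.
Qed.

Lemma lebesgue_itvoo_le (R : realType) (a b c : R) : b - a <= c -> 0 <= c ->
  (lebesgue_measure (`]a, b[%classic : set R) <= c%:E)%E.
Proof.
move=> h c0; rewrite lebesgue_measure_itv /=; case: ifP => _; last by rewrite lee_fin.
by rewrite -EFinD lee_fin.
Qed.

Lemma lebesgueU2 (R : realType) (A B : set R) : measurable A -> measurable B ->
  (lebesgue_measure (A `|` B) <= lebesgue_measure A + lebesgue_measure B)%E.
Proof. by move=> mA mB; exact: (@measureU2 _ _ _ lebesgue_measure _ _ mA mB). Qed.

Lemma lebesgue_sigmaU (R : realType) (F : nat -> set R) :
  (forall j, measurable (F j)) ->
  (lebesgue_measure (\bigcup_j F j) <= \sum_(0 <= j <oo) lebesgue_measure (F j))%E.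
Proof.
move=> mF; have mU := bigcupT_measurable _ mF.
exact: (@measure_sigma_subadditive _ _ _ lebesgue_measure _ _ mF mU).
Qed.

(** The j-th gap together with its mirror image has length at most
2 e_J (s_j - s_{j+1}) for j >= J, and these bounds telescope to 2 e_J s_J.  A
measurable cover is produced rather than the union of the gaps itself, so that
both halves can be written as intervals. *)
Lemma gap_tail_cover (R : realType) (s e : nat -> R) (J : nat) :
  (forall j, 0 <= s j) -> (forall j, s j.+1 <= s j) ->
  (forall j, 0 <= e j) -> (forall i j, (i <= j)%N -> e j <= e i) ->
  exists B : set R, [/\ measurable B,
    forall x j, (J <= j)%N -> gap s e j `|x| -> B x &
    (lebesgue_measure B <= (2 * e J * s J)%:E)%E].
Proof.
move=> s0 sS e0 em.
pose l j : R := 2 * e J * (s (J + j)%N - s (J + j).+1).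
pose G j : set R := `]s (J + j).+1, s (J + j).+1 + l j / 2[%classic.
pose G' j : set R := `]- (s (J + j).+1 + l j / 2), - s (J + j).+1[%classic.
have l0 j : 0 <= l j / 2.
  by rewrite divr_ge0 // /l mulr_ge0 ?mulr_ge0 // subr_ge0.
have half j : e (J + j)%N * (s (J + j)%N - s (J + j).+1) <= l j / 2.
  have -> : l j / 2 = e J * (s (J + j)%N - s (J + j).+1) by rewrite /l; field.
  by apply: ler_wpM2r; rewrite ?subr_ge0 // em // leq_addr.
have mG j : measurable (G j) by exact: measurable_itv.
have mG' j : measurable (G' j) by exact: measurable_itv.
have mU j : measurable (G j `|` G' j) by exact: measurableU.
have hU j : (lebesgue_measure (G j `|` G' j) <= (l j)%:E)%E.
  apply: le_trans (@lebesgueU2 R (G j) (G' j) (mG j) (mG' j)) _.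
  have -> : l j = l j / 2 + l j / 2 by field.
  by rewrite EFinD; apply: leeD; apply: lebesgue_itvoo_le => //; lra.
exists (\bigcup_j (G j `|` G' j)); split; first exact: bigcupT_measurable.
  move=> x j /subnKC <-; rewrite /gap /= in_itv /=.
  move: (j - J)%N => i /andP[h1 h2]; exists i => //.
  have := half i; case: (ger0P x) h1 h2 => _ h1 h2 hj; [left|right];
    by rewrite /G /G' /= in_itv /=; apply/andP; split; lra.
apply: le_trans (@lebesgue_sigmaU R (fun j => G j `|` G' j) mU) _.
apply: (@le_trans _ _ (\sum_(0 <= j <oo) (l j)%:E)%E).
  by apply: lee_nneseries => j _.
apply: lime_le.
  apply: is_cvg_nneseries => j _ _; rewrite lee_fin; have := l0 j; lra.
apply: nearW => n; rewrite sumEFin lee_fin /l -mulr_sumr.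
have -> : \sum_(0 <= j < n) (s (J + j)%N - s (J + j).+1) = s J - s (J + n)%N.
  elim: n => [|n IH]; first by rewrite big_nil addn0 subrr.
  by rewrite big_nat_recr //= IH addnS; ring.
apply: ler_wpM2l; first by rewrite mulr_ge0.
by have := s0 (J + n)%N; lra.
Qed.

(** The gaps with index below J start at s_J or further from 0, hence do not
meet [-t, t]; the others are covered by gap_tail_cover. *)
Lemma gapless_measure_ge (R : realType) (s e : nat -> R) (J : nat) (t : R) :
  (forall j, 0 <= s j) -> (forall j, s j.+1 <= s j) ->
  (forall j, 0 <= e j) -> (forall i j, (i <= j)%N -> e j <= e i) ->
  0 < t <= 1 -> t <= s J ->
  ((2 * t - 2 * e J * s J)%:E <= lebesgue_measure (gapless s e `&` `[(- t)%R, t]))%E.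
Proof.
move=> s0 sS e0 em /andP[t0 t1] tJ.
have sm i j : (i <= j)%N -> s j <= s i.
  by move=> /subnKC <-; elim: (j - i)%N => [|n IH]; rewrite ?addn0 // addnS (le_trans (sS _)).
have mE := gapless_measurable s e t.
have [B [mB coverB hB]] := @gap_tail_cover R s e J s0 sS e0 em.
have sub : (`[- t, t] : set R) `<=` (gapless s e `&` `[- t, t]) `|` B.
  move=> x xt; have [xB|xB] := pselect (B x); first by right.
  left; split => //; move: xt; rewrite /= in_itv /= -ler_norml => xt.
  split; first exact: le_trans t1.
  move=> j hj; have [Jj|jJ] := leqP J j; last first.
    move: hj; rewrite /gap /= in_itv /= => /andP[h _].
    by have := sm _ _ jJ; lra.
  by apply: xB; exact: coverB hj.
have h : (lebesgue_measure (`[(- t)%R, t]%classic : set R) <=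
    lebesgue_measure ((gapless s e `&` `[(- t)%R, t]) `|` B))%E.
  apply: le_measure => //; rewrite inE; first exact: measurable_itv.
  exact: measurableU.
have {h} := le_trans h (@lebesgueU2 R _ B mE mB).
rewrite lebesgue_itv_sym // => h; rewrite EFinB leeBlDr //; apply: le_trans h _.
by rewrite leeD2l.
Qed.

(** The ratio bound on consecutive s_j makes s_J comparable to t when
s_{J+1} < t <= s_J; the missing proportion of [-t, t] is then at most c e_J. *)
Lemma gapless_density (R : realType) (s e : nat -> R) (c : R) :
  (forall j, 0 < s j) -> (forall j, s j.+1 <= s j) -> (forall j, s j <= c * s j.+1) ->
  (forall t : R, 0 < t -> exists j, s j < t) ->
  (forall j, 0 <= e j) -> (forall i j, (i <= j)%N -> e j <= e i) ->
  (forall t : R, 0 < t -> exists j, e j < t) ->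
  lebesgue_density_point (gapless s e) 0.
Proof.
move=> s0 sS sc slim e0 em elim.
have s0' j : 0 <= s j by apply: ltW.
have c0 : 0 < c by have := lt_le_trans (s0 0%N) (sc 0%N); rewrite pmulr_lgt0.
have sm i j : (i <= j)%N -> s j <= s i.
  by move=> /subnKC <-; elim: (j - i)%N => [|n IH]; rewrite ?addn0 // addnS (le_trans (sS _)).
pose m (t : R) := lebesgue_measure (gapless s e `&` `[- t, t]).
have mle (t : R) : 0 < t -> (m t <= (2 * t)%:E)%E.
  move=> t0; rewrite -lebesgue_itv_sym //.
  apply: le_measure; rewrite ?inE; [|exact: measurable_itv|by move=> x []].
  exact: gapless_measurable.
have mfin (t : R) : 0 < t -> m t \is a fin_num.
  move=> t0; rewrite ge0_fin_numE ?measure_ge0 //.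
  by apply: le_lt_trans (mle _ t0) _; rewrite ltry.
have mge (eps : R) : 0 < eps -> \forall t \near (0 : R)^'+, ((2 * t * (1 - eps))%:E <= m t)%E.
  move=> eps0; have [J0 hJ0] := elim (eps / c) (divr_gt0 eps0 c0).
  near=> t.
  have t0 : 0 < t by [].
  have t1 : t <= 1 by near: t; exact: nbhs_right_le.
  have tJ0 : t < s J0 by near: t; exact: nbhs_right_lt.
  have [j0 J0t] := slim t t0.
  have ex : exists j, s j < t by exists j0.
  case: (ex_minnP ex) => -[|J] sJ mini.
    by exfalso; have := sm 0%N J0 (leq0n _); lra.
  have tJ : t <= s J.
    by rewrite leNgt; apply/negP => /mini; rewrite ltnn.
  have JJ : (J0 <= J)%N.
    by rewrite leqNgt; apply/negP => /sm; lra.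
  have t01 : 0 < t <= 1 by rewrite t0.
  apply: le_trans (@gapless_measure_ge R s e J t s0' sS e0 em t01 tJ).
  rewrite lee_fin.
  have : s J <= c * t by apply: le_trans (sc J) _; rewrite ler_pM2l // ltW.
  have eJ : e J * c <= eps.
    rewrite -ler_pdivlMr //; apply: le_trans (ltW hJ0); exact: em.
  move=> sJt.
  have : e J * s J <= e J * (c * t) by apply: ler_wpM2l.
  have : e J * c * t <= eps * t by rewrite ler_pM2r.
  lra.
rewrite /lebesgue_density_point.
under eq_cvg do rewrite sub0r add0r.
apply/fine_cvgP; split.
  by near=> t; rewrite fin_numM //; apply: mfin.
apply/cvgrPdist_le => eps eps0; near=> t.
have t0 : 0 < t by [].
have h1 := mle t t0.
have h2 : ((2 * t * (1 - eps))%:E <= m t)%E by near: t; exact: mge.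
rewrite /= -/(m t) fineM ?mfin //=.
move: h1 h2; rewrite -(fineK (mfin t t0)) !lee_fin => h1 h2.
have a1 : fine (m t) / (2 * t) <= 1 by rewrite ler_pdivrMr ?mul1r //; lra.
have a2 : 1 - eps <= fine (m t) / (2 * t) by rewrite ler_pdivlMr //; lra.
by rewrite ger0_norm; lra.
Unshelve. all: by end_near. Qed.

(** * The cut points *)

Definition nroot {R : realType} (k : nat) (x : R) : R := x `^ (k%:R^-1).

Lemma nrootK (R : realType) (k : nat) (x : R) :
  (0 < k)%N -> 0 <= x -> nroot k x ^+ k = x.
Proof.
move=> k0 x0; rewrite -powR_mulrn ?powR_ge0 // /nroot -powRrM mulVf ?powRr1 //.
by rewrite pnatr_eq0 -lt0n.
Qed.

Lemma nroot_ge0 (R : realType) k (x : R) : 0 <= nroot k x.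
Proof. exact: powR_ge0. Qed.

(** This is exp (- j^(2/3)), the point x = exp (- u) with phi u = j. *)
Definition cut (R : realType) (j : nat) : R := expR (- nroot 9 j%:R ^+ 6).

(** The decay j^(-1/9) is the size 1 / k of the distance to the integers in
progression_just_below_integer, as j is comparable to k^9; the constant 32
absorbs the losses in just_below_integer_in_gap. *)
Definition gap_ratio (R : realType) (j : nat) : R := 32 / nroot 9 j.+1%:R.

(** With h the distance in u from k^6 to the cut point j + 1, and T the distance
between the cut points j and j + 1, the distance 4 / k to the integer j + 1
gives h <= (8 / k) T by sqr_cube_ratio and sqr_cube_ratio_lower.  Exponentiating
costs a factor 2, from exp h - 1 <= 2 h and T < exp T - 1, and replacing k by
(j + 1)^(1/9) <= 2 k costs another one. *)
Lemma just_below_integer_in_gap (R : realType) (k : R) (j : nat) :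
  16 <= k -> j.+1%:R - 4 / k <= k ^+ 9 < j.+1%:R -> gap (cut R) (gap_ratio R) j (expR (- k ^+ 6)).
Proof.
move=> k16 /andP[lo up].
pose b : R := nroot 9 j.+1%:R; pose a : R := nroot 9 j%:R.
have b9 : b ^+ 9 = j.+1%:R by rewrite nrootK.
have a9 : a ^+ 9 = j%:R by rewrite nrootK.
have a0 : 0 <= a by apply: nroot_ge0.
have b0 : 0 < b by rewrite powR_gt0.
have k0 : 0 < k by lra.
have kb : k < b by rewrite -(@ltr_pXn2r _ 9%N) ?nnegrE ?ltW // b9.
have ab : a <= b by rewrite -(@ler_pXn2r _ 9%N) ?nnegrE ?(ltW b0) // b9 a9 ler_nat.
have ik : 4 / k <= 4^-1 by rewrite ler_pdivrMr //; lra.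
have b2k : b <= 2 * k.
  rewrite -(@ler_pXn2r _ 9%N) ?nnegrE ?(ltW b0) //; last by lra.
  rewrite b9 exprMn.
  have : 1 <= k ^+ 9 by rewrite exprn_ege1 //; lra.
  have : 2 <= 2 ^+ 9 :> R by rewrite ler_eXnr //; lra.
  nra.
pose h := b ^+ 6 - k ^+ 6; pose T := b ^+ 6 - a ^+ 6.
have e6 (x : R) : x ^+ 6 = (x ^+ 3) ^+ 2 by rewrite -exprM.
have e9 (x : R) : x ^+ 9 = (x ^+ 3) ^+ 3 by rewrite -exprM.
have B0 : 0 < b ^+ 3 by rewrite exprn_gt0.
have hB : b ^+ 3 * h <= 4 / 3 * (4 / k).
  rewrite /h !e6; apply: sqr_cube_ratio => //.
  - by rewrite exprn_ge0 // ltW.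
  - by apply: lerXn2r; rewrite ?nnegrE; lra.
  - by rewrite -!e9 b9; lra.
have TB : 2 / 3 <= b ^+ 3 * T.
  have : 2 / 3 * ((b ^+ 3) ^+ 3 - (a ^+ 3) ^+ 3) <= b ^+ 3 * T.
    rewrite /T !e6; apply: sqr_cube_ratio_lower; rewrite ?exprn_ge0 //.
    by apply: lerXn2r; rewrite ?nnegrE; lra.
  by rewrite -!e9 b9 a9 -natr1; lra.
have h0 : 0 < h by rewrite /h subr_gt0 ltrXn2r // ltW.
have hT : h <= 8 / k * T.
  rewrite -(ler_pM2l B0); apply: le_trans hB _.
  have : 8 / k * (2 / 3) <= 8 / k * (b ^+ 3 * T).
    by apply: ler_wpM2l => //; rewrite divr_ge0 // ltW.
  lra.
have T0 : 0 < T by rewrite -(pmulr_rgt0 _ B0); lra.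
have hh : h <= 2^-1.
  have : 1 <= b ^+ 3 by rewrite exprn_ege1 //; lra.
  nra.
have ek : - k ^+ 6 = - b ^+ 6 + h by rewrite /h; lra.
have ea : - a ^+ 6 = - b ^+ 6 + T by rewrite /T; lra.
(* h and T must be opaque for expRD to split only these sums. *)
clearbody h T; rewrite /gap /= in_itv /= /cut -/a -/b ek ea !expRD.
have s0 := expR_gt0 (- b ^+ 6).
set s := expR _ in s0 *.
have eh1 : 1 + h < expR h by apply: expR_gt1Dx; rewrite gt_eqF.
have eT1 : 1 + T < expR T by apply: expR_gt1Dx; rewrite gt_eqF.
have eh2 : expR h <= 1 + 2 * h.
  have : 1 + - h <= expR (- h) by apply: expR_ge1Dx.
  rewrite expRN -(ler_pM2r (expR_gt0 h)) mulVf ?gt_eqF ?expR_gt0 //.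
  nra.
apply/andP; split; first by rewrite ltr_pMr //; lra.
have -> : s + gap_ratio R j * (s * expR T - s) = s * (1 + gap_ratio R j * (expR T - 1)) by ring.
rewrite ltr_pM2l //.
have fr : 16 / k <= gap_ratio R j.
  rewrite /gap_ratio -/b; have -> : 16 / k = 32 / (2 * k) by field; rewrite gt_eqF.
  by apply: ler_wpM2l => //; rewrite lef_pV2 ?posrE //; lra.
have f0 : 0 < 16 / k by rewrite divr_gt0.
have : 16 / k * (expR T - 1) <= gap_ratio R j * (expR T - 1) by apply: ler_wpM2r => //; lra.
have : 16 / k * T < 16 / k * (expR T - 1) by rewrite ltr_pM2l //; lra.
lra.
Qed.

(** Dropping the first A terms makes the progression start as far out as
progression_just_below_integer requires. *)
Lemma geometric_meets_gap (R : realType) (a q : R) :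
  0 < a -> 0 < q < 1 -> exists n j, (1 <= n)%N /\ gap (cut R) (gap_ratio R) j (a * q ^+ n).
Proof.
move=> a0 /andP[q0 q1].
pose d := - ln q; pose b := - ln a.
have d0 : 0 < d by rewrite oppr_gt0 ln_lt0 ?q0.
have aq n : a * q ^+ n = expR (- (b + n%:R * d)).
  rewrite /b /d opprD opprK expRD lnK ?posrE // mulrN opprK.
  by rewrite expRM_natl lnK ?posrE.
pose K0 := 16 + d + 3 * d ^+ 2.
have [A [A1 hA]] : exists A, (1 <= A)%N /\ K0 ^+ 6 <= b + A%:R * d.
  pose X := (`|b| + K0 ^+ 6) / d.
  exists (Num.bound X).+1; split => //.
  have K00 : 0 <= K0 by rewrite /K0; have := sqr_ge0 d; lra.
  have X0 : 0 <= X by rewrite divr_ge0 ?addr_ge0 ?exprn_ge0 // ltW.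
  have := archi_boundP X0; rewrite ltr_pdivrMr // -natr1.
  by have := ler_norm (- b); rewrite normrN; lra.
have K01 : 16 <= K0 by rewrite /K0; have := sqr_ge0 d; lra.
pose k n := nroot 6 (b + (A + n)%:R * d).
have z0 n : K0 ^+ 6 <= b + (A + n)%:R * d.
  apply: le_trans hA _; rewrite lerD2l ler_pM2r // ler_nat; exact: leq_addr.
have zp n : 0 < b + (A + n)%:R * d.
  by apply: lt_le_trans (z0 n); rewrite exprn_gt0 //; lra.
have k6 n : k n ^+ 6 = b + (A + n)%:R * d by rewrite nrootK // ltW.
have kK n : K0 <= k n.
  rewrite -(@ler_pXn2r _ 6%N) ?nnegrE ?nroot_ge0 ?k6 //; lra.
have kK0 := kK 0%N.
have [|||||m [j h]] := @progression_just_below_integer R d k d0.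
- by move=> n; have := kK n; lra.
- by move=> n; rewrite !k6 addnS -natr1; ring.
- lra.
- by move: kK0; rewrite /K0; have := sqr_ge0 d; lra.
- by move: kK0; rewrite /K0; have := sqr_ge0 d; lra.
exists (A + m)%N, j; split; first by rewrite addn_gt0 A1.
rewrite aq -k6; apply: just_below_integer_in_gap => //.
by have := kK m; lra.
Qed.

Lemma nroot_arbitrarily_large (R : realType) (x : R) :
  exists j : nat, x < nroot 9 j%:R.
Proof.
pose N := Num.bound `|x|; exists (N ^ 9)%N.
have xN : x < N%:R by apply: le_lt_trans (ler_norm x) (archi_boundP (normr_ge0 x)).
apply: lt_le_trans xN _.
by rewrite -(@ler_pXn2r _ 9%N) ?nnegrE ?nroot_ge0 // nrootK // natrX.
Qed.

Lemma nroot9_le (R : realType) (i j : nat) :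
  (i <= j)%N -> nroot 9 i%:R <= nroot 9 j%:R :> R.
Proof.
by move=> ij; rewrite -(@ler_pXn2r _ 9%N) ?nnegrE ?nroot_ge0 // !nrootK // ler_nat.
Qed.

Lemma cut_le (R : realType) (j : nat) : cut R j.+1 <= cut R j.
Proof. by rewrite ler_expR lerN2 lerXn2r ?nnegrE ?nroot_ge0 ?nroot9_le. Qed.

(** Increasing phi u by 1 increases u by at most 4 / 3. *)
Lemma cut_ratio (R : realType) (j : nat) : cut R j <= expR (4 / 3) * cut R j.+1.
Proof.
rewrite -expRD ler_expR.
set a : R := nroot 9 j%:R; set b : R := nroot 9 j.+1%:R.
have b9 : b ^+ 9 = j.+1%:R by rewrite nrootK.
have a9 : a ^+ 9 = j%:R by rewrite nrootK.
have a0 : 0 <= a by apply: nroot_ge0.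
have ab : a <= b by apply: nroot9_le.
have b1 : 1 <= b.
  by rewrite -(@ler_pXn2r _ 9%N) ?nnegrE ?nroot_ge0 // b9 expr1n ler1n.
have B1 : 1 <= b ^+ 3 by rewrite exprn_ege1.
have : b ^+ 3 * ((b ^+ 3) ^+ 2 - (a ^+ 3) ^+ 2) <= 4 / 3 * 1.
  apply: sqr_cube_ratio; first lra.
  - exact: exprn_ge0.
  - by apply: lerXn2r; rewrite ?nnegrE; lra.
  - by rewrite -!exprM b9 a9 -natr1; lra.
rewrite -!exprM => h.
have : a ^+ 6 <= b ^+ 6 by apply: lerXn2r; rewrite ?nnegrE; lra.
nra.
Qed.

Lemma cut_arbitrarily_small (R : realType) (t : R) : 0 < t -> exists j, cut R j < t.
Proof.
move=> t0; have [j hj] := @nroot_arbitrarily_large R (1 + `|ln t|).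
exists j; rewrite -[ltRHS]lnK ?posrE // ltr_expR.
have n0 := normr_ge0 (ln t).
have r1 : 1 <= nroot 9 j%:R :> R by lra.
have : nroot 9 j%:R <= nroot 9 j%:R ^+ 6 :> R by rewrite ler_eXnr.
by have := ler_norm (- ln t); rewrite normrN; lra.
Qed.

Lemma gap_ratio_ge0 (R : realType) (j : nat) : 0 <= gap_ratio R j.
Proof. by rewrite divr_ge0 ?nroot_ge0. Qed.

Lemma gap_ratio_le (R : realType) (i j : nat) : (i <= j)%N -> gap_ratio R j <= gap_ratio R i.
Proof.
move=> ij; apply: ler_wpM2l => //.
by rewrite lef_pV2 ?posrE ?powR_gt0 ?nroot9_le.
Qed.

Lemma gap_ratio_arbitrarily_small (R : realType) (t : R) : 0 < t -> exists j, gap_ratio R j < t.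
Proof.
move=> t0; have [j hj] := @nroot_arbitrarily_large R (32 / t).
exists j; rewrite /gap_ratio ltr_pdivrMr ?powR_gt0 //.
rewrite ltr_pdivrMr // in hj; rewrite mulrC; apply: lt_le_trans hj _.
by rewrite ler_pM2r // nroot9_le.
Qed.

Theorem theorem1p2 (R : realType) :
  exists E : set R, [/\ compact E, lebesgue_density_point E 0 &
    ~ contains_geometric_progression E].
Proof.
exists (gapless (cut R) (gap_ratio R)); split; first exact: gapless_compact.
- apply: (@gapless_density R _ _ (expR (4 / 3))).
  + by move=> j; exact: expR_gt0.
  + exact: cut_le.
  + exact: cut_ratio.
  + exact: cut_arbitrarily_small.
  + exact: gap_ratio_ge0.
  + exact: gap_ratio_le.
  + exact: gap_ratio_arbitrarily_small.
- case=> a [q [a0 q01 aqE]].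
  have a1 : 0 < `|a| by rewrite normr_gt0.
  have [n [j [n1 nj]]] := @geometric_meets_gap R _ _ a1 q01.
  have [_ /(_ j)] := aqE n n1; apply.
  by rewrite normrM normrX (gtr0_norm (proj1 (andP q01))).
Qed.
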